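(* Let $\mathcal{H}$ be a complex Hilbert space, let $d\geq 1$, and let $\mathbf{T}=(T_1,\ldots,T_d)\in\mathcal{B}(\mathcal{H})^d$ be a commuting tuple of operators, i.e. $T_jT_k=T_kT_j$ for all $1\le j,k\le d$. Let $\widehat{\mathbf{T}}$ be the spherical Aluthge transform of $\mathbf{T}$. Then $$\omega(\widehat{\mathbf{T}})\leq\omega(\mathbf{T}),$$ where $\omega(\cdot)$ denotes the joint numerical radius of a $d$-tuple.
   Context: $\mathcal{B}(\mathcal{H})$ is the algebra of bounded linear operators on the complex Hilbert space $\mathcal{H}$ with inner product $\langle\cdot\mid\cdot\rangle$. Joint numerical radius: for $\mathbf{T}=(T_1,\ldots,T_d)\in\mathcal{B}(\mathcal{H})^d$, $\omega(\mathbf{T}):=\sup\{(\sum_{k=1}^d|\langle T_kx\mid x\rangle|^2)^{1/2}: x\in\mathcal{H},\ \|x\|=1\}$. Polar decomposition of a tuple: regard $\mathbf{T}$ as the operator $S:\mathcal{H}\to\bigoplus_{i=1}^d\mathcal{H}$, $Sx=(T_1x,\ldots,T_dx)$. Let $S=VP$ be its (canonical) polar decomposition, so $P=(S^*S)^{1/2}=\sqrt{T_1^*T_1+\cdots+T_d^*T_d}$ is a positive operator on $\mathcal{H}$ and $V:\mathcal{H}\to\bigoplus_{i=1}^d\mathcal{H}$, $Vx=(V_1x,\ldots,V_dx)$, is the partial isometry with $\mathcal{N}(V)=\bigcap_{i}\mathcal{N}(V_i)=\mathcal{N}(P)=\bigcap_i\mathcal{N}(T_i)$. Thus $T_k=V_kP$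 for $1\le k\le d$. Spherical Aluthge transform: $\widehat{\mathbf{T}}=(\widehat{T_1},\ldots,\widehat{T_d}):=(\sqrt{P}V_1\sqrt{P},\ldots,\sqrt{P}V_d\sqrt{P})$. *)

(* Defs.v *)
From HB Require Import structures.
From mathcomp Require Import all_boot all_order all_algebra.
From mathcomp Require Import complex.
From mathcomp Require Import all_classical all_reals all_analysis.

Set Implicit Arguments.
Unset Strict Implicit.
Unset Printing Implicit Defensive.

Import Order.TTheory GRing.Theory Num.Theory Num.Def.

Local Open Scope classical_set_scope.
Local Open Scope ring_scope.

Section InnerProductSpaces.
Context (C : numClosedFieldType).

Definition dnorm (U : lmodType C) (dot : {dot U for conjC}) (x : U) : C :=
  sqrtC (dot x x).

Definition bounded_op (U W : lmodType C)
    (dotU : {dot U for conjC}) (dotW : {dot W for conjC})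
    (A : {linear U -> W}) : Prop :=
  exists M : C, forall x : U, dnorm dotW (A x) <= M * dnorm dotU x.

Definition is_adjoint (U W : lmodType C)
    (dotU : {dot U for conjC}) (dotW : {dot W for conjC})
    (A : {linear U -> W}) (B : {linear W -> U}) : Prop :=
  forall x y, dotW (A x) y = dotU x (B y).

(* On [C], [0 <= z] says that [z] is real and nonnegative. *)
Definition positive_op (U : lmodType C) (dot : {dot U for conjC})
    (A : {linear U -> U}) : Prop :=
  forall x, 0 <= dot (A x) x.

Definition is_sqrt_op (U : lmodType C) (dot : {dot U for conjC})
    (A B : {linear U -> U}) : Prop :=
  [/\ bounded_op dot dot B, positive_op dot B & B \o B =1 A].

Definition partial_isometry (U W : lmodType C)
    (dotU : {dot U for conjC}) (dotW : {dot W for conjC})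
    (V : {linear U -> W}) : Prop :=
  bounded_op dotU dotW V /\
  forall x, (forall z, V z = 0 -> dotU x z = 0) ->
    dnorm dotW (V x) = dnorm dotU x.

(* The canonical polar decomposition: [P = (S^* S)^(1/2)], and the kernel
   condition determines the partial isometry [V] off the range of [P]. *)
Definition polar_decomposition (U W : lmodType C)
    (dotU : {dot U for conjC}) (dotW : {dot W for conjC})
    (S V : {linear U -> W}) (P : {linear U -> U}) : Prop :=
  [/\ exists2 Sadj : {linear W -> U},
        is_adjoint dotU dotW S Sadj & is_sqrt_op dotU (Sadj \o S) P,
      partial_isometry dotU dotW V,
      (forall x, V x = 0 <-> P x = 0) &
      S =1 V \o P].

Section DirectSum.
Context (d : nat) (U : lmodType C) (dot : {dot U for conjC}).

Local Notation U_d := {ffun 'I_d -> U}.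

(* The inner product of the Hilbert direct sum of [d] copies of [U]. *)
Definition dsum_dot (x y : U_d) : C := \sum_(k < d) dot (x k) (y k).

Lemma dsum_dot_linearl (y : U_d) : scalar (dsum_dot^~ y).
Proof.
move=> a u v; rewrite /dsum_dot mulr_sumr -big_split/=.
by apply: eq_bigr => k _; rewrite !ffunE linearPl.
Qed.

Lemma dsum_dot_linearr (x : U_d) : linear_for (conjC \; *%R) (dsum_dot x).
Proof.
move=> a u v; rewrite /dsum_dot /= mulr_sumr -big_split/=.
by apply: eq_bigr => k _; rewrite !ffunE linearPr.
Qed.

HB.instance Definition _ :=
  @bilinear_isBilinear.Build C U_d U_d C *%R (conjC \; *%R) dsum_dot
    (dsum_dot_linearl, dsum_dot_linearr).

Lemma dsum_dot_hermitian (x y : U_d) :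
  dsum_dot x y = (-1) ^+ false * (dsum_dot y x)^*.
Proof.
rewrite expr0 mul1r /dsum_dot rmorph_sum.
by apply: eq_bigr => k _; rewrite hermC expr0 mul1r.
Qed.

HB.instance Definition _ :=
  isHermitianSesquilinear.Build C U_d false conjC dsum_dot dsum_dot_hermitian.

Lemma dsum_dot_gt0 (x : U_d) : x != 0 -> 0 < dsum_dot x x.
Proof.
move=> x0; rewrite lt_def sumr_ge0 ?andbT => [|k _]; last exact: dnorm_ge0.
apply: contraNN x0 => /eqP/psumr_eq0P x0.
apply/eqP/ffunP => k; apply/eqP; rewrite ffunE -(dnorm_eq0 dot).
by apply/eqP/x0 => // i _; exact: dnorm_ge0.
Qed.

HB.instance Definition _ := isDotProduct.Build C U_d dsum_dot dsum_dot_gt0.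

(* [T] seen as the operator [x |-> (T_1 x, ..., T_d x)]. *)
Definition column_op (T : 'I_d -> {linear U -> U}) (x : U) : U_d :=
  [ffun k => T k x].

Lemma column_op_linear (T : 'I_d -> {linear U -> U}) : linear (column_op T).
Proof. by move=> a x y; apply/ffunP => k; rewrite !ffunE linearP. Qed.

HB.instance Definition _ (T : 'I_d -> {linear U -> U}) :=
  GRing.isLinear.Build C U U_d *:%R (column_op T) (column_op_linear T).

(* [P], [V] and [Q = P^(1/2)] are determined by [T] when [U] is complete, hence
   so is [That]. *)
Definition is_spherical_aluthge (T That : 'I_d -> {linear U -> U}) : Prop :=
  exists (V : {linear U -> U_d}) (P Q : {linear U -> U}),
    [/\ polar_decomposition dot dsum_dot (column_op T) V P,
        is_sqrt_op dot P Q &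
        forall k x, That k x = Q (V (Q x) k)].

End DirectSum.
End InnerProductSpaces.

(* Completeness is part of [completeNormedModType]; this says that its norm is
   the one given by the inner product. *)
Definition is_hilbert (R : realType) (H : completeNormedModType R[i])
    (dot : {dot H for conjC}) : Prop :=
  forall x : H, `|x| = dnorm dot x.

(* When [H] is trivial the set is empty and its [sup] is [0]. *)
Definition joint_numerical_radius (R : realType) (H : lmodType R[i])
    (dot : {dot H for conjC}) (d : nat) (T : 'I_d -> {linear H -> H}) : R :=
  sup [set Num.sqrt (\sum_(k < d) complex.Re `|dot (T k x) x| ^+ 2)
      | x in [set x : H | dnorm dot x = 1]].

(* Main.v *)
Require Import Defs.
From mathcomp Require Import all_boot all_order all_algebra.
From mathcomp Require Import complex.
From mathcomp Require Import all_classical all_reals all_analysis.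
From mathcomp Require Import ring lra.
Import Num.Def.
Import Order.TTheory GRing.Theory Num.Theory.
Import numFieldNormedType.Exports.
Local Open Scope ring_scope.
Set Implicit Arguments.
Unset Strict Implicit.
Unset Printing Implicit Defensive.

(** The joint numerical radius of [T] is at most [r] exactly when
    [Re <sum_k c_k T_k z, z> <= r |c|_2 |z|^2] for all scalars [c] and all
    [z], so it is enough to treat one combination [W = sum_k c_k V_k] of the
    polar factors, with [w = r |c|_2]: from the bound [w] for [W P] one must
    get the bound [w] for [P^(1/2) W P^(1/2)].

    First, the bound passes from [W P] to the other extreme [P W]; this is
    where commutativity enters. The relation [T_j T_k = T_k T_j] forces
    [V_j P V_k = V_k P V_j] ([polar_commute]), and [V^* V P = P], so
    [P W = sum_k V_k^* V_k P W = sum_k V_k^* (W P) V_k]. Hence the quadratic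
    form of [P W] at [z] is the sum of those of [W P] at the vectors [V_k z],
    and [sum_k |V_k z|^2 <= |z|^2] ([polar_gramP], [polar_contraction]).

    Secondly, [P^(1/2) W P^(1/2)] is between the two extremes. Put
    [A = W + W^*] and [Q = P^(1/2)]; the two bounds say that
    [Re <A Q^2 z, z> <= 2 w |z|^2], and [sandwich_le] derives
    [Q A Q <= 2 w]. The reason is that [Q A Q] and [A Q^2] have the same
    nonzero spectrum: if [Q A Q x = m x], then [y = A Q x] satisfies
    [A Q^2 y = m y], so that [m] is a value of the numerical range of
    [A Q^2]. In infinite dimension the top [m] of the spectrum of [Q A Q] has
    only approximate eigenvectors, and the estimate is made quantitative.

    Only real parts of inner products matter, so [H] is viewed as a real inner
    product space. Completeness of [H] is used once, for the existence of the
    adjoints of the [V_k] ([riesz]). *)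


(** * The underlying real inner product *)

(** The common source of the Cauchy-Schwarz inequalities below, applied to
    several nonnegative quadratic forms. *)
Lemma nonneg_quadratic_discr (R : realFieldType) (a b c : R) :
  (forall t, 0 <= a + t * b *+ 2 + t ^+ 2 * c) -> b ^+ 2 <= a * c.
Proof.
move=> h; have a0 : 0 <= a by move: (h 0); rewrite !mul0r mul0rn expr0n mul0r !addr0.
case: (eqVneq c 0) h => [->|c0] h.
  rewrite mulr0; have [->|b0] := eqVneq b 0; first by rewrite expr0n.
  have := h (- (a + 1) / b); rewrite mulr0 addr0 divfK// mulr2n; lra.
have c1 : 0 < c.
  rewrite lt_def c0/= leNgt; apply/negP => c1.
  (* For negative [c], the sum of the values at [t] and [- t] is
     [2 * (a + t ^+ 2 * c)], which is negative at this [t]. *)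
  pose t := (a + b ^+ 2 + 1) / - c + 1.
  have n0 : 0 < - c by lra.
  have : (t - 1) * - c = a + b ^+ 2 + 1 by rewrite /t addrK divfK// gt_eqF.
  have : 0 <= t - 1 by rewrite /t addrK divr_ge0//; nra.
  move: (h t) (h (- t)); rewrite !mulr2n; nra.
have := h (- b / c).
have -> : a + - b / c * b *+ 2 + (- b / c) ^+ 2 * c = (a * c - b ^+ 2) / c by field.
by rewrite pmulr_lge0 ?invr_gt0// subr_ge0.
Qed.

Lemma ReD (R : rcfType) (u v : R[i]) :
  complex.Re (u + v) = complex.Re u + complex.Re v.
Proof. by case: u v => [? ?] []. Qed.

Lemma ReN (R : rcfType) (u : R[i]) : complex.Re (- u) = - complex.Re u.
Proof. by case: u. Qed.

Lemma ReZ (R : rcfType) (a : R) (u : R[i]) :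
  complex.Re (a%:C%C * u) = a * complex.Re u.
Proof. by case: u => u v /=; rewrite mul0r subr0. Qed.

Lemma Re_conj (R : rcfType) (u : R[i]) : complex.Re (conjC u) = complex.Re u.
Proof. by case: u. Qed.

Section RealInnerProduct.
Local Open Scope complex_scope.
Local Open Scope ring_scope.
Context (R : realType) (H : lmodType R[i]) (dot : {dot H for conjC}).
Implicit Types (x y z : H) (a : R).

Definition rdot x y : R := complex.Re (dot x y).

Definition sqn x : R := rdot x x.

Lemma rdotDl x y z : rdot (x + y) z = rdot x z + rdot y z.
Proof. by rewrite /rdot linearDl ReD. Qed.

Lemma rdotDr x y z : rdot x (y + z) = rdot x y + rdot x z.
Proof. by rewrite /rdot linearDr ReD. Qed.

Lemma rdotNl x y : rdot (- x) y = - rdot x y.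
Proof. by rewrite /rdot linearNl ReN. Qed.

Lemma rdotBl x y z : rdot (x - y) z = rdot x z - rdot y z.
Proof. by rewrite rdotDl rdotNl. Qed.

Lemma rdotC x y : rdot x y = rdot y x.
Proof. by rewrite /rdot hermC expr0 mul1r Re_conj. Qed.

Lemma rdotBr x y z : rdot x (y - z) = rdot x y - rdot x z.
Proof. by rewrite !(rdotC x) rdotBl. Qed.

Lemma rdotZl a x y : rdot (a%:C *: x) y = a * rdot x y.
Proof. by rewrite /rdot linearZl_LR ReZ. Qed.

Lemma rdotZr a x y : rdot x (a%:C *: y) = a * rdot x y.
Proof. by rewrite rdotC rdotZl rdotC. Qed.

Lemma rdot0l x : rdot 0 x = 0. Proof. by rewrite /rdot linear0l. Qed.

Lemma rdot_suml (I : finType) (F : I -> H) x :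
  rdot (\sum_i F i) x = \sum_i rdot (F i) x.
Proof.
by rewrite (big_morph (rdot^~ x) (id1 := 0) (op1 := +%R)) ?rdot0l// => u v; rewrite rdotDl.
Qed.

Lemma rdot_sumr (I : finType) (F : I -> H) x :
  rdot x (\sum_i F i) = \sum_i rdot x (F i).
Proof. by rewrite rdotC rdot_suml; apply: eq_bigr => i _; rewrite rdotC. Qed.

Lemma dot_sqn x : dot x x = (sqn x)%:C.
Proof.
have := dnorm_ge0 dot x; rewrite /sqn /rdot.
by case: (dot x x) => u v; rewrite lecE /= => /andP[/eqP -> _].
Qed.

Lemma sqn_ge0 x : 0 <= sqn x.
Proof. by rewrite -ler0c -dot_sqn; exact: dnorm_ge0. Qed.

Lemma sqn_eq0 x : sqn x = 0 -> x = 0.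
Proof. by move=> x0; apply/eqP; rewrite -(dnorm_eq0 dot) dot_sqn x0. Qed.

Lemma rdot_sqr_le x y : rdot x y ^+ 2 <= sqn x * sqn y.
Proof.
apply: nonneg_quadratic_discr => t.
have -> : sqn x + t * rdot x y *+ 2 + t ^+ 2 * sqn y = sqn (x + t%:C *: y).
  by rewrite /sqn !(rdotDl, rdotDr, rdotZl, rdotZr) (rdotC y x); ring.
exact: sqn_ge0.
Qed.

Lemma dnorm_sqr x : dnorm dot x ^+ 2 = (sqn x)%:C.
Proof. by rewrite /dnorm sqrtCK dot_sqn. Qed.

Lemma dnorm_eq1 x : dnorm dot x = 1 <-> sqn x = 1.
Proof.
split=> [h|h]; first by have := dnorm_sqr x; rewrite h expr1n => -[].
by rewrite /dnorm dot_sqn h sqrtC1.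
Qed.

(** Boundedness is stated with squared norms, which avoids square roots. *)
Definition sqbounded (A : H -> H) : Prop :=
  exists2 M : R, 0 <= M & forall x, sqn (A x) <= M * sqn x.

(** Linear maps enter most arguments only through the existence of an adjoint,
    which makes them real linear; hence plain functions are used here. *)
Definition radjoint (A B : H -> H) : Prop :=
  forall x y, rdot (A x) y = rdot x (B y).

End RealInnerProduct.

(** * The Riesz representation and adjoints *)

Section Riesz.
Local Open Scope complex_scope.
Local Open Scope ring_scope.
Local Open Scope classical_set_scope.
Context (R : realType).

(** Take [u] almost minimizing [J x = |x|^2 - 2 f x]: the representing vector
    would be the exact minimizer, and a small excess of [J u] over the infimum
    bounds the discriminant of [t |-> J (u + t h)]. *)
Lemma approx_riesz (H : lmodType R[i]) (dot : {dot H for conjC})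
    (f : H -> R) (M : R) :
    (forall x y, f (x + y) = f x + f y) ->
    (forall a x, f (a%:C *: x) = a * f x) ->
    0 <= M -> (forall x, f x ^+ 2 <= M * sqn dot x) ->
  forall e : R, 0 < e -> exists u, forall h,
    (rdot dot u h - f h) ^+ 2 <= e * sqn dot h.
Proof.
move=> fD fZ M0 fM e e0.
pose J x := sqn dot x - f x *+ 2.
pose E := [set J x | x in [set: H]].
have Einf : has_inf E.
  split; first by exists (J 0), 0.
  exists (- M) => _ [x _ <-]; rewrite /J.
  move: (fM x) (sqn_ge0 dot x) => h h0.
  have : f x *+ 2 <= M + sqn dot x.
    rewrite -[leRHS]ger0_norm ?addr_ge0//.
    rewrite (le_trans (ler_norm _))// -ler_sqr ?nnegrE ?normr_ge0//.
    by rewrite !real_normK ?num_real// mulr2n; have := sqr_ge0 (M - sqn dot x); nra.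
  lra.
have [_ [u _ <-] uJ] := inf_adherent e0 Einf.
exists u => h; apply: nonneg_quadratic_discr => t.
have : inf E <= J (u + t%:C *: h).
  by apply: (ge_inf Einf.2); exists (u + t%:C *: h).
rewrite /J /sqn !(rdotDl, rdotDr, rdotZl, rdotZr) fD fZ (rdotC dot h u) in uJ *.
rewrite !mulr2n in uJ *; lra.
Qed.

Lemma norm_lt_sqn (H : completeNormedModType R[i]) (dot : {dot H for conjC})
  (hH : is_hilbert dot) (x : H) (e : R) : 0 < e ->
  (`|x| < e%:C) = (sqn dot x < e ^+ 2).
Proof.
move=> e0; rewrite -ltcR -(dnorm_sqr dot) -hH rmorphXn/=.
by rewrite ltr_sqr ?nnegrE ?normr_ge0// ler0c ltW.
Qed.

(** Two approximate representing vectors are close to each other (test them on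
    their difference), so they form a Cauchy sequence. *)
Lemma riesz (H : completeNormedModType R[i]) (dot : {dot H for conjC})
    (hH : is_hilbert dot) (f : H -> R) (M : R) :
    (forall x y, f (x + y) = f x + f y) ->
    (forall a x, f (a%:C *: x) = a * f x) ->
    0 <= M -> (forall x, f x ^+ 2 <= M * sqn dot x) ->
  exists y, forall x, f x = rdot dot x y.
Proof.
move=> fD fZ M0 fM.
have /choice[u uf] : forall n : nat, exists u, forall h,
    (rdot dot u h - f h) ^+ 2 <= n.+1%:R^-1 * sqn dot h.
  by move=> n; apply: approx_riesz fD fZ M0 fM _ _; rewrite invr_gt0.
have sqn_le n k : sqn dot (u n - u k) <= (n.+1%:R^-1 + k.+1%:R^-1) *+ 2.
  set h := u n - u k.
  have := uf n h; have := uf k h.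
  have : sqn dot h = rdot dot (u n) h - rdot dot (u k) h by rewrite -rdotBl.
  move: (sqn_ge0 dot h) (rdot dot (u n) h) (rdot dot (u k) h).
  have : 0 <= k.+1%:R^-1 :> R by rewrite invr_ge0.
  have : 0 <= n.+1%:R^-1 :> R by rewrite invr_ge0.
  move: (sqn dot h) (f h) n.+1%:R^-1 k.+1%:R^-1 => s v p q p0 q0 s0 a b sE.
  have sE2 : s ^+ 2 = (a - v - (b - v)) ^+ 2 by rewrite sE; ring.
  have := sqr_ge0 (a - v + (b - v)).
  rewrite leNgt mulr2n => h0 h2 h1; apply/negP => h3.
  have : s ^+ 2 <= (p + q + (p + q)) * s by rewrite sE2; nra.
  nra.
have small (e : R) : 0 < e -> exists N, forall n, (N <= n)%N -> n.+1%:R^-1 < e.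
  move=> e0; have := near_infty_natSinv_lt (PosNum e0).
  by move=> [N _ hN]; exists N.
have : cvg (u @ \oo).
  apply/cauchy_cvgP/cauchy_exP => e e0.
  have eE : e = (complex.Re e)%:C by rewrite RRe_real ?gtr0_real.
  have e1 : 0 < complex.Re e by rewrite -ltcR -eE.
  move: eE e1; set r := complex.Re e => eE r0.
  have [|N hN] := small (r ^+ 2 / 4); first by nra.
  exists (u N), N => // n /= Nn; rewrite -ball_normE /= eE (norm_lt_sqn hH)//.
  apply: le_lt_trans (sqn_le _ _) _; move: (hN n Nn) (hN N (leqnn N)).
  by rewrite mulr2n; move: n.+1%:R^-1 N.+1%:R^-1 => p q; lra.
move=> /cvg_ex[y uy]; exists y => h.
apply/eqP; rewrite eq_sym -subr_eq0 -sqrf_eq0; apply/eqP/le_anti.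
rewrite sqr_ge0 andbT; apply/ler_addgt0Pl => e e0; rewrite addr0.
pose s := sqn dot h; have s0 : 0 <= s by exact: sqn_ge0.
(* With [n.+1%:R^-1] and the squared distance to [y] both at most [r <= 1], the
   error is at most [4 * r * s]; the summand [1] in [s + 1] covers [s = 0]. *)
pose r := Num.min 1 (e / (4 * (s + 1))).
have r0 : 0 < r by rewrite lt_min ltr01 divr_gt0//; lra.
have r1 : r <= 1 by rewrite ge_min lexx.
have rs : 4 * r * s <= e.
  have : r <= e / (4 * (s + 1)) by rewrite ge_min lexx orbT.
  rewrite ler_pdivlMr; last by lra.
  by nra.
have [N hN] := small r r0.
have : \forall n \near \oo, `|y - u n| < r%:C.
  by move/cvgrPdist_lt : uy; apply; rewrite ltcR.
move=> [N' _ hN'].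
pose n := maxn N N'.
have yn : sqn dot (y - u n) < r ^+ 2.
  by rewrite -(norm_lt_sqn hH)//; apply: hN'; exact: leq_maxr.
have en : n.+1%:R^-1 < r by apply: hN; exact: leq_maxl.
have := uf n h; have := rdot_sqr_le dot (y - u n) h.
rewrite rdotBl -/s (rdotC dot h y).
have h1 : sqn dot (y - u n) * s <= r * s by rewrite ler_wpM2r//; nra.
have h2 : n.+1%:R^-1 * s <= r * s by rewrite ler_wpM2r// ltW.
move: (rdot dot y h) (rdot dot (u n) h) (f h) => a b v h3 h4.
have h5 : (a - b) ^+ 2 <= r * s := le_trans h3 h1.
have h6 : (b - v) ^+ 2 <= r * s := le_trans h4 h2.
have := sqr_ge0 (a - b - (b - v)).
nra.
Qed.

Lemma sqbounded_radjoint (H : completeNormedModType R[i])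
    (dot : {dot H for conjC}) (hH : is_hilbert dot) (A : H -> H) :
    (forall x y, A (x + y) = A x + A y) ->
    (forall a x, A (a%:C *: x) = a%:C *: A x) ->
    sqbounded dot A -> exists B, radjoint dot A B.
Proof.
move=> AD AZ [M M0 AM].
have /choice[B AB] : forall y, exists z, forall x, rdot dot (A x) y = rdot dot x z.
  move=> y; apply: (@riesz H dot hH (fun x => rdot dot (A x) y) (M * sqn dot y)).
  - by move=> x x'; rewrite AD rdotDl.
  - by move=> a x; rewrite AZ rdotZl.
  - by rewrite mulr_ge0// sqn_ge0.
  - move=> x; apply: le_trans (rdot_sqr_le _ _ _) _.
    by rewrite mulrAC ler_wpM2r// sqn_ge0.
by exists B.
Qed.

End Riesz.

(** * From a bound on A Q^2 to a bound on Q A Q *)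

Section Sandwich.
Local Open Scope complex_scope.
Local Open Scope ring_scope.
Local Open Scope classical_set_scope.
Context (R : realType) (H : lmodType R[i]) (dot : {dot H for conjC}).
Local Notation "<< x , y >>" := (rdot dot x y).
Local Notation sq := (sqn dot).

Lemma radjointC (A B : H -> H) : radjoint dot A B -> radjoint dot B A.
Proof. by move=> AB x y; rewrite rdotC -AB rdotC. Qed.

Lemma rdot_bounded_le (A : H -> H) (M : R) : 0 <= M ->
  (forall x, sq (A x) <= M * sq x) ->
  forall x, `|<<A x, x>>| <= (M + 1) * sq x.
Proof.
move=> M0 AM x; have s0 := sqn_ge0 dot x.
rewrite -ler_sqr ?nnegrE ?normr_ge0 ?mulr_ge0 ?addr_ge0//.
rewrite real_normK ?num_real//.
apply: le_trans (rdot_sqr_le _ _ _) _.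
apply: le_trans (ler_wpM2r s0 (AM x)) _.
rewrite exprMn -mulrA -expr2 ler_wpM2r ?sqr_ge0//; nra.
Qed.

(** [m] is the top of the numerical range. The form [m - B] is nonnegative, so
    Cauchy-Schwarz for it shows that a unit vector where it is almost zero is
    almost in the kernel of [m - B]. *)
Lemma approx_eigenvector (B : H -> H) (c : R) (x0 : H) :
    radjoint dot B B -> sqbounded dot B ->
    c * sq x0 < <<B x0, x0>> ->
  exists2 m, c < m & forall e, 0 < e ->
    exists2 x, sq x = 1 & sq (m%:C *: x - B x) < e.
Proof.
move=> BB [M M0 BM] cx0.
have BDl x y z : <<B (x + y), z>> = <<B x, z>> + <<B y, z>>.
  by rewrite !BB rdotDl.
have BZl a x z : <<B (a%:C *: x), z>> = a * <<B x, z>> by rewrite !BB rdotZl.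
have Bub := rdot_bounded_le M0 BM.
pose E := [set <<B x, x>> | x in [set x | sq x = 1]].
have unit u : sq u != 0 -> exists2 a, sq (a%:C *: u) = 1 & a ^+ 2 = (sq u)^-1.
  move=> u0; exists (Num.sqrt (sq u))^-1.
    rewrite /sqn rdotZl rdotZr mulrA -expr2 exprVn sqr_sqrtr ?sqn_ge0//.
    by rewrite mulVf.
  by rewrite exprVn sqr_sqrtr ?sqn_ge0.
have x00 : sq x0 != 0.
  apply/eqP => /sqn_eq0 x00; move: cx0.
  by rewrite x00 BB rdot0l /sqn rdot0l mulr0 ltxx.
have [a a1 a2] := unit _ x00.
have Esup : has_sup E.
  split; first by exists <<B (a%:C *: x0), a%:C *: x0>>, (a%:C *: x0).
  exists (M + 1) => _ [x /= x1 <-]; have := Bub x.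
  by rewrite x1 mulr1 ler_norml => /andP[].
exists (sup E).
  apply: (@lt_le_trans _ _ <<B (a%:C *: x0), a%:C *: x0>>); last first.
    by apply: (ub_le_sup Esup.2); exists (a%:C *: x0).
  rewrite BZl rdotZr mulrA -expr2 a2 mulrC ltr_pdivlMr//.
  by rewrite lt_def x00 sqn_ge0.
move=> e e0; set m := sup E.
have Bm u : <<B u, u>> <= m * sq u.
  have [/eqP/sqn_eq0->|u0] := boolP (sq u == 0).
    by rewrite BB rdot0l /sqn rdot0l mulr0.
  have [b b1 b2] := unit _ u0.
  have : <<B (b%:C *: u), b%:C *: u>> <= m.
    by apply: (ub_le_sup Esup.2); exists (b%:C *: u).
  by rewrite BZl rdotZr mulrA -expr2 b2 mulrC ler_pdivrMr// lt_def u0 sqn_ge0.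
have disc x z : (m * <<x, z>> - <<B x, z>>) ^+ 2 <=
    (m * sq x - <<B x, x>>) * (m * sq z - <<B z, z>>).
  apply: nonneg_quadratic_discr => t.
  have := Bm (x + t%:C *: z).
  rewrite /sqn !(BDl, BZl, rdotDr, rdotDl, rdotZl, rdotZr) (rdotC dot z x).
  by rewrite (BB z x) (rdotC dot z (B x)) !mulr2n; lra.
(* [K - 1] bounds the form [m - B]; the form is made smaller than [e / K] at
   [x], which leaves room for a strict inequality. *)
pose K : R := `|m| + M + 2.
have K0 : 0 < K by rewrite /K; have := normr_ge0 m; lra.
have [_ [x /= x1 <-] xm] := sup_adherent (divr_gt0 e0 K0) Esup.
exists x => //; set z := _ - _.
have zE : sq z = m * <<x, z>> - <<B x, z>>.
  by rewrite {1}/z /sqn rdotBl rdotZl.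
have := disc x z; rewrite -zE x1 mulr1 => zz.
have z0 := sqn_ge0 dot z.
have Kz : m * sq z - <<B z, z>> <= (K - 1) * sq z.
  have := Bub z; rewrite ler_norml => /andP[+ _].
  by have := ler_norm m; rewrite /K; nra.
rewrite -/m in xm.
have d0 : 0 <= m - <<B x, x>> by have := Bm x; rewrite x1 mulr1 subr_ge0.
have eK : e / K * K = e by rewrite divfK// gt_eqF.
rewrite ltNge; apply/negP => ez.
have : (m - <<B x, x>>) * (m * sq z - <<B z, z>>) <= e / K * ((K - 1) * sq z).
  apply: le_trans (ler_wpM2l d0 Kz) _; rewrite ler_wpM2r//.
    by rewrite mulr_ge0// /K; have := normr_ge0 m; lra.
  lra.
have q0 : 0 < e / K by rewrite divr_gt0.
move: (e / K) eK q0 => q eK q0 h.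
have : sq z ^+ 2 <= q * ((K - 1) * sq z) := le_trans zz h.
nra.
Qed.

(** If [Q A Q] exceeded [c] somewhere, it would have approximate unit
    eigenvectors [x] for some [m > c]. Then [y = A Q x] is an approximate
    eigenvector of [A Q^2] for [m], and it does not become small since
    [|Q y| = |Q A Q x|] is about [m]; this contradicts the bound [c] for
    [A Q^2] at [y]. *)
Lemma sandwich_le (A Q : H -> H) (c : R) :
    radjoint dot A A -> radjoint dot Q Q ->
    sqbounded dot A -> sqbounded dot Q -> 0 <= c ->
    (forall z, <<A (Q (Q z)), z>> <= c * sq z) ->
  forall x, <<A (Q x), Q x>> <= c * sq x.
Proof.
move=> AA QQ [Ma Ma0 AM] [Mq Mq0 QM] c0 AQQ x0.
rewrite leNgt; apply/negP => x0c.
have BB : radjoint dot (Q \o A \o Q) (Q \o A \o Q).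
  by move=> x y /=; rewrite QQ AA QQ.
have BM : sqbounded dot (Q \o A \o Q).
  exists (Mq * Ma * Mq) => [|x /=]; first by rewrite !mulr_ge0.
  rewrite -!mulrA; apply: le_trans (QM _) _; rewrite ler_wpM2l//.
  by apply: le_trans (AM _) _; rewrite ler_wpM2l.
have x0c' : c * sq x0 < <<(Q \o A \o Q) x0, x0>> by rewrite /= QQ.
have [m cm eig] := approx_eigenvector BB BM x0c'.
(* The error [e] leads to [D <= e * K], where [D] does not depend on [e]. *)
pose D := (m - c) ^+ 2 * (m ^+ 2 / 4).
pose K := Mq * Ma * Mq.
have m0 : 0 < m := le_lt_trans c0 cm.
have D0 : 0 < D by rewrite /D mulr_gt0 ?divr_gt0 ?exprn_gt0 ?subr_gt0.
have K0 : 0 <= K by rewrite /K !mulr_ge0.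
pose e := Num.min (m ^+ 2 / 4) (D / (K + 1)).
have e0 : 0 < e by rewrite lt_min !divr_gt0 ?exprn_gt0 ?ltr_wpDl.
have e1 : e <= m ^+ 2 / 4 by rewrite ge_min lexx.
have eD : e * (K + 1) <= D by rewrite -ler_pdivlMr ?ge_min ?lexx ?orbT//; lra.
have [x x1 /ltW] := eig e e0; rewrite /=.
set y := A (Q x); set z := _ - _ => ze.
have QyE u : <<Q y, u>> = m * <<x, u>> - <<z, u>>.
  by rewrite /z rdotBl rdotZl; ring.
have yc : (m - c) * sq y <= <<z, Q (A y)>>.
  have := AQQ y; rewrite AA QQ QyE -QQ -AA -/y -/(sq y); nra.
have yL : (m - c) ^+ 2 * sq y <= e * (Mq * Ma).
  have [y0|y0] := eqVneq (sq y) 0.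
    by rewrite y0 mulr0 !mulr_ge0// ltW.
  have y1 : 0 < sq y by rewrite lt_def y0 sqn_ge0.
  rewrite -(ler_pM2r y1) -mulrA -expr2 -exprMn.
  apply: (@le_trans _ _ (<<z, Q (A y)>> ^+ 2)).
    by rewrite ler_sqr ?nnegrE//; [nra|apply: le_trans yc; nra].
  apply: le_trans (rdot_sqr_le _ _ _) _; rewrite -[leRHS]mulrA.
  apply: ler_pM; rewrite ?sqn_ge0// -mulrA.
  by apply: le_trans (QM _) _; rewrite ler_wpM2l.
(* [y] stays away from zero: [<y, Q x> = <Q y, x>] is at least [m / 2]. *)
have my : m ^+ 2 / 4 <= sq y * Mq.
  have h1 : (m - <<Q y, x>>) ^+ 2 <= e.
    have := rdot_sqr_le dot z x.
    have -> : <<z, x>> = m - <<Q y, x>>.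
      by rewrite /z rdotBl rdotZl -/(sq x) x1 mulr1.
    by rewrite x1 mulr1 => /le_trans; apply.
  have h2 : <<Q y, x>> ^+ 2 <= sq y * Mq.
    rewrite QQ; apply: le_trans (rdot_sqr_le _ _ _) _.
    by rewrite ler_wpM2l ?sqn_ge0//; have := QM x; rewrite x1 mulr1.
  have h3 : m / 2 <= <<Q y, x>> by rewrite leNgt; apply/negP => h3; nra.
  apply: le_trans h2; nra.
have : D <= e * K.
  rewrite /D /K; apply: (@le_trans _ _ ((m - c) ^+ 2 * (sq y * Mq))).
    by rewrite ler_wpM2l// sqr_ge0.
  by rewrite !mulrA ler_wpM2r// -mulrA.
lra.
Qed.

End Sandwich.

(** * Adjoints and bounded maps *)

Section Adjoints.
Local Open Scope complex_scope.
Local Open Scope ring_scope.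
Context (R : realType) (H : lmodType R[i]) (dot : {dot H for conjC}).
Local Notation "<< x , y >>" := (rdot dot x y).
Local Notation sq := (sqn dot).

Lemma rdot_eq0 (x : H) : (forall y, <<x, y>> = 0) -> x = 0.
Proof. by move=> x0; apply: (sqn_eq0 (dot := dot)); exact: x0. Qed.

Lemma dot_conj (x y : H) : dot x y = conjC (dot y x).
Proof. by rewrite {1}hermC expr0 mul1r. Qed.

Lemma rdot0r (x : H) : <<x, 0>> = 0.
Proof. by rewrite rdotC rdot0l. Qed.

Lemma radjoint0 (A B : H -> H) : radjoint dot A B -> A 0 = 0.
Proof. by move=> AB; apply: rdot_eq0 => y; rewrite AB rdot0l. Qed.

(** Complex scalars do not commute with the real inner product as real ones
    do: the adjoint of a scaling is the scaling by the conjugate. *)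
Lemma rdotJ (c : R[i]) (x y : H) : <<c *: x, y>> = <<x, conjC c *: y>>.
Proof. by rewrite /rdot linearZl_LR linearZr_LR/= conjCK. Qed.

Lemma sqnZ (c : R[i]) (x : H) : sq (c *: x) = complex.Re (c * conjC c) * sq x.
Proof.
rewrite {1}/sqn /rdot linearZl_LR linearZr_LR /= mulrA dot_sqn.
by case: (c * conjC c) => u v /=; rewrite mulr0 subr0.
Qed.

Lemma sqnD_le (x y : H) : sq (x + y) <= 2 * sq x + 2 * sq y.
Proof.
have := sqn_ge0 dot (x - y).
by rewrite /sqn !(rdotBl, rdotBr, rdotDl, rdotDr) (rdotC dot y x); lra.
Qed.

Lemma sqboundedD (A B : H -> H) : sqbounded dot A -> sqbounded dot B ->
  sqbounded dot (fun x => A x + B x).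
Proof.
move=> [M M0 AM] [N N0 BN]; exists (2 * M + 2 * N) => [|x]; first by lra.
apply: le_trans (sqnD_le _ _) _.
by rewrite [leRHS]mulrDl -!mulrA lerD// ler_wpM2l.
Qed.

Lemma sqbounded_sum (I : finType) (c : I -> R[i]) (A : I -> H -> H) :
  (forall i, sqbounded dot (A i)) ->
  sqbounded dot (fun x => \sum_i c i *: A i x).
Proof.
move=> Ab; elim: (index_enum I) => [|i s IHs].
  exists 0 => // x; rewrite big_nil.
  by rewrite /sqn rdot0l mul0r.
have -> : (fun x => \sum_(j <- i :: s) c j *: A j x) =
    (fun x => c i *: A i x + \sum_(j <- s) c j *: A j x).
  by apply/funext => x; rewrite big_cons.
apply: sqboundedD => //; have [M M0 AM] := Ab i.
have n0 : 0 <= complex.Re (c i * conjC (c i)).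
  by rewrite -ler0c RRe_real ?ger0_real ?mul_conjC_ge0.
by exists (complex.Re (c i * conjC (c i)) * M) => [|x];
  rewrite ?mulr_ge0// sqnZ -mulrA ler_wpM2l.
Qed.

Lemma radjoint_sqbounded (A B : H -> H) : radjoint dot A B ->
  sqbounded dot A -> sqbounded dot B.
Proof.
move=> AB [M M0 AM]; exists M => // y.
have [->|By] := eqVneq (sq (B y)) 0; first by rewrite mulr_ge0 ?sqn_ge0.
have By0 : 0 < sq (B y) by rewrite lt_def By sqn_ge0.
rewrite -(ler_pM2l By0) -expr2 {1}/sqn -AB.
apply: le_trans (rdot_sqr_le _ _ _) _.
by rewrite mulrCA mulrA ler_wpM2r ?sqn_ge0.
Qed.

(** The form [g x y = <A x, y> - <x, A y>] vanishes on the diagonal; comparing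
    the sums [x + y] and ['i *: x + y] shows that it is both skew-symmetric and
    symmetric. *)
Lemma positive_op_sym (A : {linear H -> H}) : positive_op dot A ->
  forall x y, dot (A x) y = dot x (A y).
Proof.
move=> A0.
pose g x y := dot (A x) y - dot x (A y).
have g0 x : g x x = 0.
  by rewrite /g [dot x _]dot_conj (CrealP (ger0_real (A0 x))) subrr.
have gDl x y z : g (x + y) z = g x z + g y z.
  by rewrite /g (linearD A) (linearDl dot) (linearDl dot)/= opprD addrACA.
have gDr x y z : g x (y + z) = g x y + g x z.
  by rewrite /g (linearD A) (linearDr dot) (linearDr dot)/= opprD addrACA.
have gZl x y : g ('i *: x) y = 'i * g x y.
  by rewrite /g (linearZ_LR A) (linearZl_LR dot) (linearZl_LR dot)/= -mulrBr.
have gZr x y : g x ('i *: y) = - 'i * g x y.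
  by rewrite /g (linearZ_LR A) (linearZr_LR dot) (linearZr_LR dot)/= conjCi -mulrBr.
have gD x y : g x y = - g y x.
  have := g0 (x + y); rewrite gDl !gDr !g0 add0r addr0 => /eqP.
  by rewrite addr_eq0 => /eqP.
have gZ x y : 'i * g x y = 'i * g y x.
  by have := gD ('i *: x) y; rewrite gZl gZr mulNr opprK.
move=> x y; apply/eqP; rewrite -subr_eq0 -/(g x y); apply/eqP.
have /(mulfI (neq0Ci _)) gS := gZ x y.
have : g x y + g x y = 0 by rewrite {1}gD gS addNr.
by move=> /eqP; rewrite -mulr2n mulrn_eq0/= => /eqP.
Qed.

Lemma positive_op_radjoint (A : {linear H -> H}) : positive_op dot A ->
  radjoint dot A A.
Proof. by move=> A0 x y; rewrite /rdot positive_op_sym. Qed.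

Lemma bounded_op_sqbounded (U : lmodType R[i]) (dotU : {dot U for conjC})
    (A : {linear H -> U}) : bounded_op dot dotU A ->
  exists2 M, 0 <= M & forall x, sqn dotU (A x) <= M * sq x.
Proof.
move=> [M AM].
have ME : `|M| ^+ 2 = (complex.Re (`|M| ^+ 2))%:C.
  by rewrite RRe_real ?ger0_real ?exprn_ge0.
exists (complex.Re (`|M| ^+ 2)) => [|x]; first by rewrite -ler0c -ME exprn_ge0.
have d0 : 0 <= dnorm dot x by rewrite sqrtC_ge0 dnorm_ge0.
have e0 : 0 <= dnorm dotU (A x) by rewrite sqrtC_ge0 dnorm_ge0.
have : dnorm dotU (A x) ^+ 2 <= `|M| ^+ 2 * dnorm dot x ^+ 2.
  rewrite -exprMn ler_sqr ?nnegrE ?mulr_ge0//.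
  rewrite -(ger0_norm d0) -normrM ger0_norm ?AM//.
  exact: le_trans (AM x).
by rewrite ME !dnorm_sqr -rmorphM lecR.
Qed.

(** For symmetric [P] the sum of [ran P] and [ker P] is dense. Density is
    replaced by a computation with the adjoint: [F P = 0] gives [P F' = 0], so
    [F F' = 0] by the hypothesis on [ker P], and then [F' = 0]. *)
Lemma radjoint_eq0 (P F F' : H -> H) :
    radjoint dot P P -> radjoint dot F F' ->
    (forall x, F (P x) = 0) -> (forall x, P x = 0 -> F x = 0) ->
  forall x, F x = 0.
Proof.
move=> PP FF FP Fker x.
have F'0 y : F' y = 0.
  have PF' : P (F' y) = 0.
    by apply: rdot_eq0 => z; rewrite PP rdotC -FF FP rdot0l.
  apply: (sqn_eq0 (dot := dot)).
  by rewrite /sqn -FF Fker// rdot0l.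
by apply: rdot_eq0 => y; rewrite FF F'0 rdot0r.
Qed.

End Adjoints.

(** * Polar factors of a tuple *)

Section PolarFactors.
Local Open Scope complex_scope.
Local Open Scope ring_scope.
Context (R : realType) (H : lmodType R[i]) (dot : {dot H for conjC}).
Local Notation "<< x , y >>" := (rdot dot x y).
Local Notation sq := (sqn dot).
Context (d : nat) (V V' : 'I_d -> H -> H) (P : H -> H).
Context (PP : radjoint dot P P).
Context (VV' : forall k, radjoint dot (V k) (V' k)).
Context (Vker : forall x, P x = 0 -> forall k, V k x = 0).
Context (Viso : forall x y,
  \sum_k <<V k (P x), V k (P y)>> = <<P x, P y>>).

Let G x := \sum_k V' k (V k x).

Let Gl x y : <<G x, y>> = \sum_k <<V k x, V k y>>.
Proof.
rewrite rdot_suml; apply: eq_bigr => k _.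
by rewrite rdotC -VV' rdotC.
Qed.

Let Gr x y : <<x, G y>> = \sum_k <<V k x, V k y>>.
Proof. by rewrite rdotC Gl; apply: eq_bigr => k _; rewrite rdotC. Qed.

(** This says that [V^* V P = P]. It holds because [P V^* V - P] vanishes on
    both the range and the kernel of [P]. *)
Lemma polar_gramP x y : \sum_k <<V k x, V k (P y)>> = <<x, P y>>.
Proof.
pose F u := P (G u) - P u.
suff /(_ x) F0 : forall u, F u = 0.
  have /eqP : <<F x, y>> = 0 by rewrite F0 rdot0l.
  by rewrite rdotBl !PP Gl subr_eq0 => /eqP.
apply: (radjoint_eq0 (F' := fun u => G (P u) - P u) PP) => [u v|u|u Pu0].
- by rewrite rdotBl rdotBr !PP Gl Gr.
- by apply: (rdot_eq0 (dot := dot)) => w; rewrite rdotBl (PP (G _)) (PP (P _)) Gl Viso subrr.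
- apply: (rdot_eq0 (dot := dot)) => w; rewrite rdotBl PP Gl Pu0 rdot0l.
  by rewrite big1 ?subrr// => k _; rewrite Vker// rdot0l.
Qed.

(** [G = V^* V] is the orthogonal projection onto the closure of [ran P]:
    [x - G x] is orthogonal to [ran P], hence killed by [P], hence by [V]. *)
Lemma polar_contraction x : \sum_k sq (V k x) <= sq x.
Proof.
pose w := x - G x.
have Pw : P w = 0.
  apply: (rdot_eq0 (dot := dot)) => u.
  by rewrite PP rdotBl Gl polar_gramP subrr.
have wG : <<w, G x>> = 0.
  by rewrite Gr big1// => k _; rewrite Vker// rdot0l.
rewrite rdotBl Gr in wG.
have := sqn_ge0 dot w; rewrite /sqn rdotBl !rdotBr Gr Gl.
by move: wG; lra.
Qed.

(** On [ran P] the relation is [T_j T_k = T_k T_j], and both sides vanish on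
    [ker P]. *)
Lemma polar_commute (T : 'I_d -> H -> H) :
    (forall k x, T k x = V k (P x)) ->
    (forall j k x, T j (T k x) = T k (T j x)) ->
  forall j k x, V j (P (V k x)) = V k (P (V j x)).
Proof.
move=> TE Tcomm j k x; apply/eqP; rewrite -subr_eq0; apply/eqP.
pose F u := V j (P (V k u)) - V k (P (V j u)).
pose F' u := V' k (P (V' j u)) - V' j (P (V' k u)).
apply: (@radjoint_eq0 _ _ dot P F F') PP _ _ _ x => [u v|u|u Pu0].
- by rewrite rdotBl rdotBr !VV' !PP !VV'.
- by rewrite /F -!TE Tcomm subrr.
- by rewrite /F !(Vker Pu0) !(radjoint0 PP) !(radjoint0 (VV' _)) subrr.
Qed.

End PolarFactors.

(** * Combinations of the Aluthge transforms *)

Section WeightedAluthge.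
Local Open Scope complex_scope.
Local Open Scope ring_scope.
Context (R : realType) (H : lmodType R[i]) (dot : {dot H for conjC}).
Local Notation "<< x , y >>" := (rdot dot x y).
Local Notation sq := (sqn dot).

(** The core of the theorem, for [W = sum_k c_k V_k]: the bound for [W P]
    passes to [P W], and then to [Q W Q] by [sandwich_le] for [A = W + W^*]. *)
Lemma aluthge_combination_le (d : nat) (V V' : 'I_d -> H -> H)
    (P Q : {linear H -> H}) (c : 'I_d -> R[i]) (w : R) :
    radjoint dot P P -> radjoint dot Q Q -> sqbounded dot Q ->
    (forall x, P x = Q (Q x)) ->
    (forall k a x y, V k (a *: x + y) = a *: V k x + V k y) ->
    (forall k, sqbounded dot (V k)) ->
    (forall k, radjoint dot (V k) (V' k)) ->
    (forall x, P x = 0 -> forall k, V k x = 0) ->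
    (forall x y, \sum_k <<V k (P x), V k (P y)>> = <<P x, P y>>) ->
    (forall j k x, V j (P (V k x)) = V k (P (V j x))) ->
    0 <= w ->
    (forall z, <<\sum_k c k *: V k (P z), z>> <= w * sq z) ->
  forall x, <<\sum_k c k *: V k (Q x), Q x>> <= w * sq x.
Proof.
move=> PP QQ Qb PQ Vlin Vb VV' Vker Viso Vcomm w0 Wnum x.
pose W u := \sum_k c k *: V k u.
pose W' u := \sum_k V' k (conjC (c k) *: u).
have WW' : radjoint dot W W'.
  move=> u v; rewrite rdot_suml rdot_sumr; apply: eq_bigr => k _.
  by rewrite rdotJ VV'.
have Wb : sqbounded dot W by exact: sqbounded_sum.
pose A u := W u + W' u.
have AA : radjoint dot A A.
  by move=> u v; rewrite rdotDl rdotDr WW' (radjointC WW') addrC.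
have Ab : sqbounded dot A.
  by apply: sqboundedD => //; exact: radjoint_sqbounded WW' Wb.
have V0 k : V k 0 = 0 by exact: radjoint0 (VV' k).
have VPW k u : V k (P (W u)) = W (P (V k u)).
  rewrite /W linear_sum/=.
  transitivity (\sum_j c j *: V k (P (V j u))).
    rewrite (big_morph (V k) (id1 := 0) (op1 := +%R)) ?V0//; last first.
      by move=> y z; rewrite -[y]scale1r Vlin !scale1r.
    apply: eq_bigr => j _; rewrite linearZ_LR.
    by rewrite -[_ *: P _]addr0 Vlin V0 addr0.
  by apply: eq_bigr => j _; rewrite Vcomm.
(* [P W = sum_k V_k^* V_k P W = sum_k V_k^* W P V_k], so the bound for [W P] is
   used at each [V k z]. *)
have PWnum z : <<P (W z), z>> <= w * sq z.
  rewrite rdotC -(polar_gramP PP VV' Vker Viso).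
  rewrite (eq_bigr (fun k => <<W (P (V k z)), V k z>>)); last first.
    by move=> k _; rewrite VPW rdotC.
  apply: (@le_trans _ _ (\sum_k w * sq (V k z))).
    by apply: ler_sum => k _; exact: Wnum.
  rewrite -mulr_sumr ler_wpM2l//.
  exact: (polar_contraction PP VV' Vker Viso).
have Anum z : <<A (Q (Q z)), z>> <= 2 * w * sq z.
  rewrite -PQ rdotDl (radjointC WW') (PP z) (rdotC dot z).
  by have := Wnum z; have := PWnum z; rewrite -/(W (P z)); lra.
have w2 : 0 <= 2 * w by lra.
have := sandwich_le AA QQ Ab Qb w2 Anum x.
by rewrite rdotDl (radjointC WW') (rdotC dot (Q x)) -/(W (Q x)); lra.
Qed.

End WeightedAluthge.

(** * The joint numerical radius *)

Section JointNumericalRadius.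
Local Open Scope complex_scope.
Local Open Scope ring_scope.
Local Open Scope classical_set_scope.
Context (R : realType).

Lemma Re_norm_sqr (u : R[i]) : complex.Re `|u| ^+ 2 = complex.Re (conjC u * u).
Proof.
by rewrite mulrC -normCK normc_def !expr2 /= mulr0 subr0.
Qed.

Lemma sum_Re_mul_sqr_le (I : finType) (c b : I -> R[i]) :
  (\sum_i complex.Re (c i * b i)) ^+ 2 <=
  (\sum_i complex.Re `|c i| ^+ 2) * (\sum_i complex.Re `|b i| ^+ 2).
Proof.
apply: nonneg_quadratic_discr => t.
rewrite mulr_sumr mulr_sumr -sumrMnl -!big_split/=; apply: sumr_ge0 => i _.
rewrite !Re_norm_sqr; case: (c i) (b i) => [p q] [r s] /=.
have := sqr_ge0 (p + t * r); have := sqr_ge0 (q - t * s).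
by rewrite !mulr2n; nra.
Qed.

Context (H : lmodType R[i]) (dot : {dot H for conjC}).
Local Notation sq := (sqn dot).

(** Cauchy-Schwarz for the complex inner product, from the real one after
    multiplying [x] by the scalar that makes [<x, y>] real and nonnegative. *)
Lemma norm_dot_sqr_le (x y : H) :
  complex.Re `|dot x y| ^+ 2 <= sq x * sq y.
Proof.
set b := dot x y; set n := complex.Re `|b| ^+ 2.
have nE : rdot dot (conjC b *: x) y = n.
  by rewrite /n Re_norm_sqr /rdot linearZl_LR.
have := rdot_sqr_le dot (conjC b *: x) y.
rewrite nE sqnZ conjCK -Re_norm_sqr -/n.
have n0 : 0 <= n by exact: sqr_ge0.
have := sqn_ge0 dot x; have := sqn_ge0 dot y.
have [->|n1] := eqVneq n 0; first by move=> *; rewrite mulr_ge0.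
by move=> _ _; rewrite -mulrA expr2 ler_pM2l// lt_def n1.
Qed.

Context (d : nat) (T : 'I_d -> {linear H -> H}).
Context (Tb : forall k, bounded_op dot dot (T k)).

Lemma joint_numerical_radius_has_ubound :
  has_ubound [set Num.sqrt (\sum_(k < d) complex.Re `|dot (T k x) x| ^+ 2)
             | x in [set x : H | dnorm dot x = 1]].
Proof.
have /choice[M MP] : forall k, exists M, forall x, sq (T k x) <= M * sq x.
  by move=> k; have [M _ MP] := bounded_op_sqbounded (Tb k); exists M.
exists (Num.sqrt (\sum_k M k)) => _ [x /= /dnorm_eq1 x1 <-].
rewrite ler_wsqrtr//; apply: ler_sum => k _.
apply: le_trans (norm_dot_sqr_le _ _) _.
by rewrite x1 mulr1 (le_trans (MP k x))// x1 mulr1.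
Qed.

Lemma joint_numerical_radius_ge0 : 0 <= joint_numerical_radius dot T.
Proof.
rewrite /joint_numerical_radius; move: joint_numerical_radius_has_ubound.
set E := [set _ | _ in _] => Eub.
have [->|/set0P[y Ey]] := eqVneq E set0; first by rewrite sup0.
apply: le_trans (ub_le_sup Eub Ey).
by case: Ey => x _ <-; exact: sqrtr_ge0.
Qed.

(** Homogeneity extends the defining bound from unit vectors to all vectors. *)
Lemma joint_numerical_radius_sqr_ge (x : H) :
  \sum_k complex.Re `|dot (T k x) x| ^+ 2 <=
  (joint_numerical_radius dot T * sq x) ^+ 2.
Proof.
have s0 := sqn_ge0 dot x.
have [/eqP/sqn_eq0->|x0] := boolP (sq x == 0).
  rewrite big1 ?sqr_ge0// => k _.
  have -> : dot (T k 0) 0 = 0 by exact: linear0r.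
  by rewrite normr0 expr0n.
pose a := (Num.sqrt (sq x))^-1.
have a2 : a ^+ 2 = (sq x)^-1 by rewrite exprVn sqr_sqrtr.
pose y := a%:C *: x.
have y1 : sq y = 1.
  by rewrite /sqn rdotZl rdotZr mulrA -expr2 a2 mulVf.
have xy k : complex.Re `|dot (T k y) y| ^+ 2 =
    complex.Re `|dot (T k x) x| ^+ 2 / sq x ^+ 2.
  rewrite /y (linearZ_LR (T k)) (linearZl_LR dot) (linearZr_LR dot)/=.
  set b := dot _ _.
  rewrite !Re_norm_sqr -exprVn -a2.
  case: b => p q /=; ring.
have : Num.sqrt (\sum_k complex.Re `|dot (T k y) y| ^+ 2) <=
    joint_numerical_radius dot T.
  apply: (ub_le_sup joint_numerical_radius_has_ubound).
  by exists y => //=; apply/dnorm_eq1.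
rewrite -[leRHS]ger0_norm ?joint_numerical_radius_ge0// -sqrtr_sqr.
rewrite ler_sqrt ?sqr_ge0// (eq_bigr _ (fun k _ => xy k)) -mulr_suml.
by rewrite ler_pdivrMr ?exprn_gt0 ?lt_def ?x0// exprMn.
Qed.

End JointNumericalRadius.

(** * The spherical Aluthge transform *)

Lemma Re_dsum_dot (R : realType) (H : lmodType R[i]) (dot : {dot H for conjC})
    (d : nat) (x y : {ffun 'I_d -> H}) :
  complex.Re (dsum_dot dot x y) = \sum_k rdot dot (x k) (y k).
Proof.
by rewrite /dsum_dot (big_morph (@complex.Re R) (id1 := 0) (op1 := +%R))//;
  exact: ReD.
Qed.

Unset Implicit Arguments.

Theorem theorem2p3 (R : realType) (H : completeNormedModType R[i])
    (dot : {dot H for conjC}) (hH : is_hilbert dot)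
    (d : nat) (hd : (1 <= d)%N) (T : 'I_d -> {linear H -> H})
    (hT : forall k, bounded_op dot dot (T k))
    (hcomm : forall j k x, T j (T k x) = T k (T j x))
    (That : 'I_d -> {linear H -> H})
    (hThat : is_spherical_aluthge dot T That) :
  joint_numerical_radius dot That <= joint_numerical_radius dot T.
Proof.
case: hThat => V [P [Q [[[Sadj Sadjoint [_ P0 PPE]] [Vbd _] kerVP SE]
  [Qbd Q0 QQE] ThatE]]].
pose W k x : H := V x k.
have Wlin k a x y : W k (a *: x + y) = a *: W k x + W k y.
  by rewrite /W linearP !ffunE.
have PP : radjoint dot P P := positive_op_radjoint P0.
have QQ : radjoint dot Q Q := positive_op_radjoint Q0.
have TE k x : T k x = W k (P x).
  by rewrite /W -[V (P x)](SE x) ffunE.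
have Wb k : sqbounded dot (W k).
  have [M M0 VM] := bounded_op_sqbounded Vbd.
  exists M => // x; apply: le_trans (VM x).
  by rewrite {2}/sqn /rdot Re_dsum_dot (bigD1 k)//= lerDl sumr_ge0// => j _; exact: sqn_ge0.
have /choice[W' WW'] : forall k, exists B, radjoint dot (W k) B.
  move=> k; apply: (sqbounded_radjoint hH) => // [x y|a x].
  - by rewrite -[x in LHS]scale1r Wlin scale1r.
  - by rewrite -[_ *: x]addr0 Wlin /W linear0 ffunE addr0.
have Wker x : P x = 0 -> forall k, W k x = 0.
  by move=> /kerVP Vx0 k; rewrite /W Vx0 ffunE.
have Wiso x y : \sum_k rdot dot (W k (P x)) (W k (P y)) = rdot dot (P x) (P y).
  rewrite PP [P (P y)]PPE /rdot -Sadjoint Re_dsum_dot.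
  by apply: eq_bigr => k _; rewrite !ffunE !TE.
have Wcomm := polar_commute PP WW' Wker TE hcomm.
set r := joint_numerical_radius dot T.
have r0 : 0 <= r := joint_numerical_radius_ge0 hT.
rewrite {1}/joint_numerical_radius; set E := (X in sup X).
have [->|/set0P E0] := eqVneq E set0; first by rewrite sup0.
apply: ge_sup => // _ [x /= /dnorm_eq1 x1 <-].
(* The coefficients [conjC (a k)] give equality in Cauchy-Schwarz: the
   combination then has real part [s], the square of the quantity to bound. *)
pose a k := dot (That k x) x; pose s := \sum_k complex.Re `|a k| ^+ 2.
rewrite -/s.
have s0 : 0 <= s by apply: sumr_ge0 => k _; exact: sqr_ge0.
have num z : rdot dot (\sum_k conjC (a k) *: W k (P z)) z <=
    Num.sqrt s * r * sqn dot z.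
  have w0 : 0 <= Num.sqrt s * r * sqn dot z.
    by rewrite !mulr_ge0 ?sqrtr_ge0 ?sqn_ge0.
  apply: le_trans (ler_norm _) _.
  rewrite -ler_sqr ?nnegrE// real_normK ?num_real//.
  rewrite rdot_suml.
  rewrite (eq_bigr (fun k => complex.Re (conjC (a k) * dot (T k z) z))); last first.
    by move=> k _; rewrite -TE /rdot linearZl_LR.
  apply: le_trans (sum_Re_mul_sqr_le _ _) _.
  rewrite -mulrA exprMn sqr_sqrtr//; apply: ler_pM.
  - by apply: sumr_ge0 => k _; exact: sqr_ge0.
  - by apply: sumr_ge0 => k _; exact: sqr_ge0.
  - by rewrite /s; under eq_bigr do rewrite norm_conjC.
  - exact: joint_numerical_radius_sqr_ge hT z.
have w0 : 0 <= Num.sqrt s * r by rewrite mulr_ge0 ?sqrtr_ge0.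
have PQ y : P y = Q (Q y) := esym (QQE y).
have := aluthge_combination_le PP QQ (bounded_op_sqbounded Qbd) PQ Wlin Wb WW'
  Wker Wiso Wcomm w0 num x.
have -> : rdot dot (\sum_k conjC (a k) *: W k (Q x)) (Q x) = s.
  rewrite rdot_suml; apply: eq_bigr => k _.
  rewrite Re_norm_sqr /rdot linearZl_LR /=; congr (complex.Re (_ * _)).
  by rewrite /a ThatE (positive_op_sym Q0).
rewrite x1 mulr1 -{1}[s]sqr_sqrtr// expr2.
have [->|ss] := eqVneq (Num.sqrt s) 0; first by [].
by rewrite ler_pM2l// lt_def ss sqrtr_ge0.
Qed.
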